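(* Suppose that $(\lambda_0,\lambda_1)\in\mathbb{C}^2$ and $(\lambda_2,\lambda_3)\in\mathbb{C}^2$ are conjugation invariant and let $\varepsilon>0$. Then there exists $\delta>0$ (such that $\Phi_{(\lambda_0,\lambda_1)}$ and $\Phi_{(\lambda_2,\lambda_3)}$ have no zeros in $(0,\delta]$, so that the entries below are well defined) such that the estimate $$|R_{j,j-1}|+|R_{j,j+1}|\le\left(\tfrac12+\varepsilon\right)|R_{j,j}|,\qquad j=2,\dots,n-1,$$ holds for all $n\ge 3$ and all partitions $t_1<\dots<t_n$ such that $t_{j+1}-t_j\le\delta$ for $j=1,\dots,n-1$.
   Context: A vector $(\mu_0,\dots,\mu_N)$ of complex numbers is conjugation invariant if there is a permutation $p$ of $\{0,\dots,N\}$ with $\overline{\mu_j}=\mu_{p(j)}$ for all $j$. For $(\mu_0,\dots,\mu_N)\in\mathbb{C}^{N+1}$ let $\Phi_{(\mu_0,\dots,\mu_N)}$ (the fundamental function) be the unique solution of $\prod_{j=0}^N(\frac{d}{dx}-\mu_j)\Phi=0$ on $\mathbb{R}$ with $\Phi^{(k)}(0)=0$ for $k=0,\dots,N-1$ and $\Phi^{(N)}(0)=1$. Define, where the denominators do not vanish, $$\rho(x)=\frac{\Phi'_{(\lambda_0,\dots,\lambda_3)}(x)\Phi_{(\lambda_0,\lambda_1)}(x)-\Phi_{(\lambda_0,\dots,\lambda_3)}(x)\Phi'_{(\lambda_0,\lambda_1)}(x)}{\Phi_{(\lambda_0,\lambda_1)}(x)\Phi_{(\lambda_2,\lambda_3)}(x)},\qquad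 \sigma(x)=\frac{\Phi_{(\lambda_0,\dots,\lambda_3)}(x)}{\Phi_{(\lambda_0,\lambda_1)}(x)\Phi_{(\lambda_2,\lambda_3)}(x)}.$$ For $t_1<\dots<t_n$ and $j=2,\dots,n-1$ the entries of the tridiagonal matrix $R$ are $$R_{j,j}=\rho(t_j-t_{j-1})-\rho(-(t_{j+1}-t_j)),\quad R_{j,j+1}=\sigma(t_{j+1}-t_j),\quad R_{j,j-1}=-\sigma(-(t_j-t_{j-1})).$$ (The $(n-2)\times(n-2)$ matrix is $R=(R_{i,j})_{2\le i,j\le n-1}$; the numbers $R_{2,1}$ and $R_{n-1,n}$ are also defined by these formulas.) *)

(* Defs.v *)
(* Stdlib reals with Coquelicot. *)
From Stdlib Require Import Reals List Arith FinFun ClassicalEpsilon.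
From Coquelicot Require Import Coquelicot.
Import ListNotations.

Open Scope R_scope.

(** A vector [(mu_0, ..., mu_N)] of complex numbers is a list of length [N + 1]. *)

(** On the finite set [{0, ..., N}] an injective self-map is a permutation. *)
Definition conj_invariant (mus : list C) : Prop :=
  exists p : nat -> nat,
    bFun (length mus) p /\ bInjective (length mus) p /\
    forall j : nat, (j < length mus)%nat ->
      Cconj (nth j mus (RtoC 0)) = nth (p j) mus (RtoC 0).

(** Derivatives of functions of a real variable with complex values are taken on
    real and imaginary parts. *)
Definition ex_CDerive_n (f : R -> C) (k : nat) (x : R) : Prop :=
  ex_derive_n (fun y => Re (f y)) k x /\ ex_derive_n (fun y => Im (f y)) k x.

Definition CDerive_n (f : R -> C) (k : nat) (x : R) : C :=
  (Derive_n (fun y => Re (f y)) k x, Derive_n (fun y => Im (f y)) k x).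

Definition CDerive (f : R -> C) : R -> C := CDerive_n f 1.

(** [diff_op [mu_0; ...; mu_N] f] is [(d/dx - mu_0) ... (d/dx - mu_N) f]. *)
Fixpoint diff_op (mus : list C) (f : R -> C) : R -> C :=
  match mus with
  | [] => f
  | mu :: mus' =>
      fun x => (CDerive (diff_op mus' f) x - mu * diff_op mus' f x)%C
  end.

(** Since [Derive] is total, the differentiability of a solution up to the order
    of the equation has to be required explicitly. *)
Definition is_fundamental (mus : list C) (f : R -> C) : Prop :=
  (forall (k : nat) (x : R), (k <= length mus)%nat -> ex_CDerive_n f k x) /\
  (forall x : R, diff_op mus f x = RtoC 0) /\
  (forall k : nat, (k < length mus - 1)%nat -> CDerive_n f k 0 = RtoC 0) /\
  CDerive_n f (length mus - 1) 0 = RtoC 1.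

(** For a non-empty vector [mus] there is exactly one function satisfying
    [is_fundamental mus], and this is the one that is selected. *)
Definition Phi (mus : list C) : R -> C :=
  epsilon (inhabits (fun _ : R => RtoC 0)) (is_fundamental mus).

(** In [rho], [sigma] and [Rmat] the parameters stand for
    [lambda_0, ..., lambda_3]; division by zero is total, so the values are
    meaningful only where the denominators do not vanish. *)
Definition rho (l0 l1 l2 l3 : C) (x : R) : C :=
  ((CDerive (Phi [l0; l1; l2; l3]) x * Phi [l0; l1] x
    - Phi [l0; l1; l2; l3] x * CDerive (Phi [l0; l1]) x)
   / (Phi [l0; l1] x * Phi [l2; l3] x))%C.

Definition sigma (l0 l1 l2 l3 : C) (x : R) : C :=
  (Phi [l0; l1; l2; l3] x / (Phi [l0; l1] x * Phi [l2; l3] x))%C.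

(** The nodes are [t 1 < ... < t n]; rows are the indices [2 <= i <= n - 1], and
    columns [1] and [n] are included for the entries [R_{2,1}], [R_{n-1,n}]. *)
Definition Rmat (l0 l1 l2 l3 : C) (t : nat -> R) (i j : nat) : C :=
  if Nat.eqb j i then
    (rho l0 l1 l2 l3 (t i - t (i - 1)%nat)
     - rho l0 l1 l2 l3 (- (t (i + 1)%nat - t i)))%C
  else if Nat.eqb j (i + 1) then sigma l0 l1 l2 l3 (t (i + 1)%nat - t i)
  else if Nat.eqb (j + 1) i then
    (- sigma l0 l1 l2 l3 (- (t i - t (i - 1)%nat)))%C
  else RtoC 0.

(* Main.v *)
Require Import Defs.
From Stdlib Require Import Reals List Arith Lra Lia ClassicalEpsilon FunctionalExtensionality.
From Coquelicot Require Import Coquelicot.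
Import ListNotations.
Open Scope R_scope.

(** Only the behaviour of the fundamental functions at the origin matters.  A
    fundamental function [f] of a vector with [N + 1] entries vanishes to order
    [N] at [0] with [N]-th derivative [1], so by Taylor's formula
    [f^(k)(x) / x^(N - k) -> 1 / (N - k)!] as [x -> 0], from both sides
    ([fundamental_lim]).  Hence the functions [Phi] of two entries behave like
    [x] and those of four entries like [x^3 / 6], and

    - [sigma x / x -> 1/6] ([sigma_lim]),
    - [rho x / x -> 1/2 - 1/6 = 1/3] ([rho_lim]).

    In a row with left step [h] and right step [h'] the two off-diagonal entries
    therefore have total modulus at most [(1/6 + eta) (h + h')], while the
    diagonal entry [rho h - rho (- h')] has modulus at least
    [(1/3 - eta) (h + h')], because [rho] is odd to leading order and the two
    contributions add up.  The ratio tends to [1/2] as [eta -> 0]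
    ([row_estimate]).

    Since [Phi] is a choice among all functions with the defining properties,
    these properties can be used only once a fundamental function is known to
    exist.  This is [fundamental_exists]: the inner factors of the operator are
    appended one at a time, each by solving a first order linear equation
    explicitly. *)

(** * Complex-valued functions of a real variable and linear equations *)

Definition is_Cderive (f : R -> C) (x : R) (l : C) : Prop :=
  is_derive (fun y => Re (f y)) x (Re l) /\
  is_derive (fun y => Im (f y)) x (Im l).

Lemma CDerive_n_0 (f : R -> C) (x : R) : CDerive_n f 0 x = f x.
Proof. unfold CDerive_n; simpl; now destruct (f x). Qed.

Lemma is_Cderive_unique (f : R -> C) (x : R) (l : C) :
  is_Cderive f x l -> CDerive f x = l.
Proof.
  intros [hr hi]; unfold CDerive, CDerive_n; simpl.
  destruct l; f_equal; now apply is_derive_unique.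
Qed.

Lemma is_derive_primitive (p : R -> R) (x : R) :
  (forall y, continuous p y) -> is_derive (fun y => RInt p 0 y) x (p x).
Proof.
  intros hp; apply (is_derive_RInt p _ 0); [|apply hp].
  apply filter_forall; intros y.
  apply (RInt_correct (V := R_CompleteNormedModule)).
  apply (ex_RInt_continuous (V := R_CompleteNormedModule)); auto.
Qed.

(** Variation of constants:
    [f(x) = e^(mu x) (c + int_0^x e^(- mu s) g(s) ds)].  For [mu = a + i b] the
    functions [p] and [q] below are the real and imaginary parts of the
    integrand. *)
Lemma linear_first_order (mu c : C) (g : R -> C) :
  (forall x, continuous (fun y => Re (g y)) x) ->
  (forall x, continuous (fun y => Im (g y)) x) ->
  exists f : R -> C, f 0 = c /\
    forall x, is_Cderive f x (mu * f x + g x)%C.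
Proof.
  intros hr hi; destruct mu as [a b], c as [cr ci].
  set (p := fun x => exp (- (a * x)) *
    (cos (b * x) * Re (g x) + sin (b * x) * Im (g x))).
  set (q := fun x => exp (- (a * x)) *
    (cos (b * x) * Im (g x) - sin (b * x) * Re (g x))).
  assert (he : forall x, continuous (fun y => exp (- (a * y))) x).
  { intros x; apply (ex_derive_continuous (V := R_NormedModule)); auto_derive; auto. }
  assert (hc : forall x, continuous (fun y => cos (b * y)) x).
  { intros x; apply (ex_derive_continuous (V := R_NormedModule)); auto_derive; auto. }
  assert (hs : forall x, continuous (fun y => sin (b * y)) x).
  { intros x; apply (ex_derive_continuous (V := R_NormedModule)); auto_derive; auto. }
  assert (hp : forall x, is_derive (fun y => RInt p 0 y) x (p x)).
  { intros x; apply is_derive_primitive; intros y.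
    apply (continuous_mult (K := R_AbsRing)); [apply he|].
    apply (continuous_plus (V := R_NormedModule));
      now apply (continuous_mult (K := R_AbsRing)). }
  assert (hq : forall x, is_derive (fun y => RInt q 0 y) x (q x)).
  { intros x; apply is_derive_primitive; intros y.
    apply (continuous_mult (K := R_AbsRing)); [apply he|].
    apply (continuous_minus (V := R_NormedModule));
      now apply (continuous_mult (K := R_AbsRing)). }
  assert (hp0 : RInt p 0 0 = 0) by apply (RInt_point (V := R_CompleteNormedModule)).
  assert (hq0 : RInt q 0 0 = 0) by apply (RInt_point (V := R_CompleteNormedModule)).
  set (P := fun y => RInt p 0 y) in *; set (Q := fun y => RInt q 0 y) in *.
  change (P 0 = 0) in hp0; change (Q 0 = 0) in hq0; clearbody P Q.
  exists (fun x =>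
    (exp (a * x) * (cos (b * x) * (cr + P x) - sin (b * x) * (ci + Q x)),
     exp (a * x) * (sin (b * x) * (cr + P x) + cos (b * x) * (ci + Q x)))).
  split.
  - rewrite hp0, hq0, !Rmult_0_r, exp_0, cos_0, sin_0; f_equal; ring.
  - intros x.
    assert (hexp : exp (- (a * x)) = / exp (a * x)) by apply exp_Ropp.
    assert (hpos : exp (a * x) <> 0) by apply Rgt_not_eq, exp_pos.
    assert (htrig : cos (b * x) * cos (b * x) = 1 - sin (b * x) * sin (b * x)).
    { generalize (sin2_cos2 (b * x)); unfold Rsqr; lra. }
    assert (hPx : Derive (fun y => P y) x = p x) by (apply is_derive_unique, hp).
    assert (hQx : Derive (fun y => Q y) x = q x) by (apply is_derive_unique, hq).
    assert (eP : ex_derive (fun y => P y) x) by (exists (p x); apply hp).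
    assert (eQ : ex_derive (fun y => Q y) x) by (exists (q x); apply hq).
    split; simpl; auto_derive; auto; rewrite hPx, hQx; unfold p, q;
      rewrite hexp; fold (Re (g x)) (Im (g x)); field_simplify; auto;
      unfold pow; rewrite ?Rmult_1_r, ?htrig; unfold Re, Im; ring.
Qed.

(** An equation [f' = mu f + g] gains one derivative: [f] is once more
    differentiable than [g], and the differentiated equation is the recursion
    that propagates initial values from [g] to [f]. *)
Lemma CDerive_n_linear (mu : C) (f g : R -> C) (n : nat) :
  (forall x, is_Cderive f x (mu * f x + g x)%C) ->
  (forall k x, (k <= n)%nat -> ex_CDerive_n g k x) ->
  (forall k x, (k <= S n)%nat -> ex_CDerive_n f k x) /\
  (forall k x, (k <= n)%nat ->
     CDerive_n f (S k) x = (mu * CDerive_n f k x + CDerive_n g k x)%C).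
Proof.
  intros hf hg.
  assert (H : forall k, (k <= n)%nat -> forall x, ex_CDerive_n f (S k) x /\
     CDerive_n f (S k) x = (mu * CDerive_n f k x + CDerive_n g k x)%C).
  { induction k as [|k IH]; intros hk x.
    - split.
      + destruct (hf x) as [hr hi]; split; eexists; [exact hr | exact hi].
      + rewrite !CDerive_n_0; apply is_Cderive_unique, hf.
    - assert (hk' : (k <= n)%nat) by lia.
      destruct (IH hk' x) as [[er ei] _].
      destruct (hg (S k) x hk) as [gr gi].
      assert (H : is_Cderive (CDerive_n f (S k)) x
         (mu * CDerive_n f (S k) x + CDerive_n g (S k) x)%C).
      { destruct er as [dr er], ei as [di ei], gr as [dgr gr], gi as [dgi gi].
        unfold CDerive_n at 2 3; simpl Derive_n.
        rewrite (is_derive_unique _ _ _ er), (is_derive_unique _ _ _ ei).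
        rewrite (is_derive_unique _ _ _ gr), (is_derive_unique _ _ _ gi).
        destruct mu as [a b].
        split.
        - apply is_derive_ext with
            (fun y => (a * Derive_n (fun z => Re (f z)) k y
               - b * Derive_n (fun z => Im (f z)) k y)
               + Derive_n (fun z => Re (g z)) k y).
          + intros y; destruct (IH hk' y) as [_ ->]; reflexivity.
          + simpl. apply (is_derive_plus (V := R_NormedModule)); auto.
            apply (is_derive_minus (V := R_NormedModule));
            now apply is_derive_scal.
        - apply is_derive_ext with
            (fun y => (a * Derive_n (fun z => Im (f z)) k y
               + b * Derive_n (fun z => Re (f z)) k y)
               + Derive_n (fun z => Im (g z)) k y).
          + intros y; destruct (IH hk' y) as [_ ->]; reflexivity.
          + simpl. apply (is_derive_plus (V := R_NormedModule)); auto.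
            apply (is_derive_plus (V := R_NormedModule));
            now apply is_derive_scal. }
      split.
      + destruct H as [hr hi]; split; eexists; [exact hr | exact hi].
      + exact (is_Cderive_unique _ _ _ H). }
  split.
  - intros [|k] x hk; [split; exact I|].
    apply H; lia.
  - intros k x hk; now apply H.
Qed.

(** * Existence of fundamental functions *)

(** The last entry of the vector is the factor that acts first, so appending an
    entry amounts to replacing the unknown [f] by [f' - mu f]. *)
Lemma diff_op_snoc (mus : list C) (mu : C) (f : R -> C) :
  diff_op (mus ++ [mu]) f = diff_op mus (fun x => CDerive f x - mu * f x)%C.
Proof.
  induction mus as [|nu mus IH]; [reflexivity|].
  simpl; now rewrite IH.
Qed.

(** If [g] is fundamental for a vector, then the solution of [f' - nu f = g] with
    [f 0 = 0] is fundamental for that vector with [nu] appended: differentiating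
    [f' = nu f + g] at [0] shifts the initial values of [g] by one order.  A
    vector with a single entry is the homogeneous case with [f 0 = 1]. *)
Lemma fundamental_exists (mu : C) (mus : list C) :
  exists f, is_fundamental (mu :: mus) f.
Proof.
  induction mus as [|nu mus IH] using rev_ind.
  - destruct (linear_first_order mu (RtoC 1) (fun _ => RtoC 0))
      as [f [f0 hf]]; try (intros; apply continuous_const).
    destruct (CDerive_n_linear mu f (fun _ => RtoC 0) 0 hf) as [ex _].
    { intros k x hk; replace k with 0%nat by lia; split; exact I. }
    exists f; repeat split; try (simpl; intros; lia).
    + now apply ex.
    + now apply ex.
    + intros x; simpl; rewrite (is_Cderive_unique _ _ _ (hf x)); ring.
    + simpl; now rewrite CDerive_n_0.
  - destruct IH as [g (exg & opg & init & lead)].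
    set (N := length mus); simpl length in *.
    fold N in exg, init, lead; rewrite Nat.sub_succ, Nat.sub_0_r in init, lead.
    destruct (linear_first_order nu (RtoC 0) g) as [f [f0 hf]].
    { intros x; apply (ex_derive_continuous (V := R_NormedModule)).
      apply (exg 1%nat x); lia. }
    { intros x; apply (ex_derive_continuous (V := R_NormedModule)).
      apply (exg 1%nat x); lia. }
    destruct (CDerive_n_linear nu f g (S N) hf) as [ex rec].
    { intros k x hk; apply exg; lia. }
    assert (zero : forall k, (k <= N)%nat -> CDerive_n f k 0 = RtoC 0).
    { induction k as [|k IHk]; intros hk; [now rewrite CDerive_n_0|].
      rewrite rec, IHk, init by lia; ring. }
    exists f; unfold is_fundamental.
    change (mu :: mus ++ [nu]) with ((mu :: mus) ++ [nu]).
    replace (length ((mu :: mus) ++ [nu])) with (S (S N))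
      by (rewrite length_app; simpl; unfold N; lia).
    rewrite Nat.sub_succ, Nat.sub_0_r.
    split; [|split; [|split]].
    + intros k x hk; apply ex; lia.
    + intros x; rewrite diff_op_snoc.
      replace (fun y => (CDerive f y - nu * f y)%C) with g; [apply opg|].
      apply functional_extensionality; intros y.
      rewrite (is_Cderive_unique _ _ _ (hf y)); ring.
    + intros k hk; apply zero; lia.
    + rewrite rec, zero, lead by lia; ring.
Qed.

Lemma Phi_fundamental (mu : C) (mus : list C) :
  is_fundamental (mu :: mus) (Phi (mu :: mus)).
Proof. unfold Phi; apply epsilon_spec, fundamental_exists. Qed.

(** * Leading term at the origin *)

(** This is [f x = a x^n + o(x^n)] at [0].  The point [x = 0] is included, so
    that integrating the estimate with the mean value theorem needs no exception
    at the origin. *)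
Definition equiv_pow (f : R -> R) (n : nat) (a : R) : Prop :=
  forall eps : posreal,
    locally 0 (fun x => Rabs (f x - a * x ^ n) <= eps * Rabs x ^ n).

(** The mean value inequality for [f x - a x^(n+1) / (n+1)], whose derivative is
    at most [eps |y|^n] between [0] and [y]. *)
Lemma equiv_pow_primitive (f : R -> R) (n : nat) (a : R) :
  f 0 = 0 -> (forall x, ex_derive f x) -> equiv_pow (Derive f) n a ->
  equiv_pow f (S n) (a / INR (S n)).
Proof.
  intros f0 df asym eps; destruct (asym eps) as [d hd].
  exists d; intros y hy.
  assert (hn : INR (S n) <> 0) by (apply not_0_INR; lia).
  assert (hy' : Rabs y < d) by (replace y with (minus y 0) by (compute; ring); exact hy).
  generalize (bounded_variation (fun x => f x - a / INR (S n) * x ^ S n)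
    (fun x => Derive f x - a * x ^ n) (eps * Rabs y ^ n) 0 y).
  rewrite f0, pow_i, !Rmult_0_r, !Rminus_0_r by lia.
  intros H; replace (eps * Rabs y ^ S n) with (eps * Rabs y ^ n * Rabs y)
    by (simpl; ring).
  apply H.
  intros t; rewrite Rminus_0_r; intros ht; split.
  - apply (is_derive_minus (V := R_NormedModule)).
    + apply Derive_correct, df.
    + replace (a * t ^ n) with (a / INR (S n) * (INR (S n) * 1 * t ^ n))
        by (field; exact hn).
      apply is_derive_scal, (is_derive_pow (fun x => x)).
      apply (is_derive_id (K := R_AbsRing)).
  - eapply Rle_trans.
    + apply hd; change (Rabs (t - 0) < d); rewrite Rminus_0_r; lra.
    + apply Rmult_le_compat_l; [apply Rlt_le, cond_pos|].
      apply pow_incr; split; [apply Rabs_pos | exact ht].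
Qed.

(** Taylor's formula with Peano's remainder on both sides of [0], by integrating
    the expansion of order [0] of the [n]-th derivative [n] times. *)
Lemma taylor_leading_term (n : nat) : forall f : R -> R,
  (forall k x, (k <= S n)%nat -> ex_derive_n f k x) ->
  (forall k, (k < n)%nat -> Derive_n f k 0 = 0) ->
  equiv_pow f n (Derive_n f n 0 / INR (fact n)).
Proof.
  induction n as [|n IH]; intros f df f0.
  - intros eps.
    assert (hc : continuous f 0)
      by (apply (ex_derive_continuous (V := R_NormedModule)), (df 1%nat 0); lia).
    generalize (proj1 (filterlim_locally _ _) hc eps).
    apply filter_imp; intros x hx; simpl.
    change (Rabs (f x - f 0) < eps) in hx.
    replace (f x - f 0 / 1 * 1) with (f x - f 0) by field; lra.
  - assert (shift : forall k x, Derive_n (Derive f) k x = Derive_n f (S k) x).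
    { intros k x; change (Derive f) with (Derive_n f 1).
      rewrite Derive_n_comp; f_equal; lia. }
    replace (Derive_n f (S n) 0 / INR (fact (S n)))
      with (Derive_n (Derive f) n 0 / INR (fact n) / INR (S n)).
    + apply equiv_pow_primitive.
      * apply (f0 0%nat); lia.
      * intros x; apply (df 1%nat); lia.
      * apply IH; [|intros k hk; rewrite shift; apply f0; lia].
        intros [|k] x hk; [exact I|]; simpl.
        apply ex_derive_ext with (Derive_n f (S k)); [intros; now rewrite shift|].
        apply (df (S (S k)) x); lia.
    + rewrite shift, fact_simpl, mult_INR; field.
      split; [apply INR_fact_neq_0 | apply not_0_INR; lia].
Qed.

Lemma equiv_pow_lim (f : R -> R) (n : nat) (a : R) :
  equiv_pow f n a -> is_lim (fun x => f x / x ^ n) 0 a.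
Proof.
  intros asym; apply is_lim_spec; intros eps.
  destruct (asym (pos_div_2 eps)) as [d hd]; exists d; intros y hy hy0.
  assert (hp : 0 < Rabs y ^ n) by now apply pow_lt, Rabs_pos_lt.
  assert (y ^ n <> 0) by now apply pow_nonzero.
  replace (f y / y ^ n - a) with ((f y - a * y ^ n) / y ^ n) by now field.
  unfold Rdiv; rewrite Rabs_mult, Rabs_inv, <- RPow_abs.
  apply Rmult_lt_reg_r with (Rabs y ^ n); [exact hp|].
  rewrite Rmult_assoc, Rinv_l, Rmult_1_r by lra.
  eapply Rle_lt_trans; [apply (hd y hy)|].
  apply Rmult_lt_compat_r; [exact hp|].
  simpl; generalize (cond_pos eps); lra.
Qed.

(** * Limits of complex-valued functions at the origin *)

(** The limit is over punctured neighbourhoods of [0]: the quotients below have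
    no meaning at [0]. *)
Definition is_Clim0 (f : R -> C) (l : C) : Prop :=
  is_lim (fun x => Re (f x)) 0 (Re l) /\ is_lim (fun x => Im (f x)) 0 (Im l).

Lemma is_Clim0_ext (f g : R -> C) (l : C) :
  Rbar_locally' 0 (fun x => f x = g x) -> is_Clim0 f l -> is_Clim0 g l.
Proof.
  intros fg [hr hi]; split.
  - apply is_lim_ext_loc with (fun x => Re (f x)); [|exact hr].
    revert fg; apply filter_imp; now intros x ->.
  - apply is_lim_ext_loc with (fun x => Im (f x)); [|exact hi].
    revert fg; apply filter_imp; now intros x ->.
Qed.

Lemma is_lim_mult_finite (f g : R -> R) (x : Rbar) (a b : R) :
  is_lim f x a -> is_lim g x b -> is_lim (fun y => f y * g y) x (a * b).
Proof. intros hf hg; now apply (is_lim_mult f g x a b). Qed.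

Lemma is_Clim0_mult (f g : R -> C) (l m : C) :
  is_Clim0 f l -> is_Clim0 g m -> is_Clim0 (fun x => f x * g x)%C (l * m)%C.
Proof.
  intros [fr fi] [gr gi]; split; simpl.
  - eapply is_lim_minus;
      [apply is_lim_mult_finite; [exact fr | exact gr]
      | apply is_lim_mult_finite; [exact fi | exact gi] | reflexivity].
  - eapply is_lim_plus;
      [apply is_lim_mult_finite; [exact fr | exact gi]
      | apply is_lim_mult_finite; [exact fi | exact gr] | reflexivity].
Qed.

Lemma is_Clim0_minus (f g : R -> C) (l m : C) :
  is_Clim0 f l -> is_Clim0 g m -> is_Clim0 (fun x => f x - g x)%C (l - m)%C.
Proof.
  intros [fr fi] [gr gi]; split; simpl;
    eapply is_lim_minus; try eassumption; reflexivity.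
Qed.

Lemma is_Clim0_inv (f : R -> C) (l : C) :
  l <> RtoC 0 -> is_Clim0 f l -> is_Clim0 (fun x => / f x)%C (/ l)%C.
Proof.
  intros hl [fr fi].
  assert (hpos : Re l ^ 2 + Im l ^ 2 <> 0).
  { intros h; apply hl; destruct l as [a b]; simpl in h.
    apply injective_projections; simpl; nra. }
  assert (hnorm : is_lim (fun x => Re (f x) ^ 2 + Im (f x) ^ 2) 0
    (Re l ^ 2 + Im l ^ 2)).
  { apply (is_lim_plus _ _ 0 (Re l ^ 2) (Im l ^ 2)); [| |reflexivity]; simpl pow;
      repeat apply is_lim_mult_finite; try assumption; apply is_lim_const. }
  assert (hinv := is_lim_inv _ _ _ hnorm (fun h => hpos (f_equal real h))).
  split; simpl; unfold Rdiv; apply is_lim_mult_finite; try assumption.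
  now apply (is_lim_opp _ _ (Im l)).
Qed.

Lemma Cmod_le_Re_Im (z : C) : Cmod z <= Rabs (Re z) + Rabs (Im z).
Proof.
  assert (e : z = (RtoC (Re z) + Ci * RtoC (Im z))%C)
    by (apply injective_projections; simpl; unfold Re, Im; ring).
  rewrite e at 1; eapply Rle_trans; [apply Cmod_triangle|].
  rewrite Cmod_mult, Cmod_Ci, !Cmod_R, Rmult_1_l; apply Rle_refl.
Qed.

Lemma is_Clim0_near (f : R -> C) (l : C) (eta : R) :
  is_Clim0 f l -> 0 < eta -> Rbar_locally' 0 (fun x => Cmod (f x - l)%C < eta).
Proof.
  intros [fr fi] heta; apply is_lim_spec in fr, fi.
  assert (h2 : 0 < eta / 2) by lra.
  generalize (filter_and _ _ (fr (mkposreal _ h2)) (fi (mkposreal _ h2))).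
  apply filter_imp; intros x [hr hi].
  eapply Rle_lt_trans; [apply Cmod_le_Re_Im|].
  simpl in hr, hi |- *; unfold Rminus in hr, hi; unfold Re, Im in *; lra.
Qed.

Lemma is_Clim0_neq (f : R -> C) (l : C) :
  is_Clim0 f l -> l <> RtoC 0 -> Rbar_locally' 0 (fun x => f x <> RtoC 0).
Proof.
  intros hf hl; generalize (is_Clim0_near f l _ hf (proj1 (Cmod_gt_0 l) hl)).
  apply filter_imp; intros x hx h0; rewrite h0 in hx.
  replace (RtoC 0 - l)%C with (- l)%C in hx by ring.
  rewrite Cmod_opp in hx; lra.
Qed.

Lemma near_neq_0 : Rbar_locally' 0 (fun x => RtoC x <> RtoC 0).
Proof.
  exists (mkposreal 1 Rlt_0_1); intros y _ hy h; apply hy; exact (f_equal Re h).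
Qed.

(** * Asymptotics of the entries *)

(** The Taylor expansion applied to the [k]-th derivative, on real and imaginary
    parts. *)
Lemma fundamental_lim (mus : list C) (f : R -> C) (k m : nat) :
  is_fundamental mus f -> length mus = S (m + k) ->
  is_Clim0 (fun x => CDerive_n f k x / RtoC (x ^ m))%C (RtoC (/ INR (fact m))).
Proof.
  intros (ex & _ & init & lead) hN; rewrite hN in *.
  rewrite Nat.sub_succ, Nat.sub_0_r in init, lead.
  assert (H : forall g : R -> R,
    (forall i x, (i <= S (m + k))%nat -> ex_derive_n g i x) ->
    (forall i, (i < m + k)%nat -> Derive_n g i 0 = 0) ->
    is_lim (fun x => Derive_n g k x / x ^ m) 0 (Derive_n g (m + k) 0 / INR (fact m))).
  { intros g dg g0; rewrite <- Derive_n_comp.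
    apply equiv_pow_lim, taylor_leading_term.
    - intros [|i] x hi; [exact I|]; simpl.
      apply ex_derive_ext with (Derive_n g (i + k)); [intros; now rewrite Derive_n_comp|].
      apply (dg (S (i + k))); lia.
    - intros i hi; rewrite Derive_n_comp; apply g0; lia. }
  assert (quot : forall (z : C) (r : R), r <> 0 ->
    (Re z / r, Im z / r) = (z / RtoC r)%C).
  { intros [a b] r hr; apply injective_projections; simpl; field; auto. }
  apply is_Clim0_ext with
    (fun x => (Re (CDerive_n f k x) / x ^ m, Im (CDerive_n f k x) / x ^ m)).
  { generalize near_neq_0; apply filter_imp; intros x hx.
    apply quot, pow_nonzero; congruence. }
  split; simpl.
  - replace (/ INR (fact m)) with
      (Derive_n (fun y => Re (f y)) (m + k) 0 / INR (fact m)).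
    + apply H; [intros; now apply ex|].
      intros i hi; exact (f_equal Re (init i hi)).
    + rewrite (f_equal Re lead : Derive_n (fun y => Re (f y)) (m + k) 0 = 1).
      unfold Rdiv; ring.
  - replace 0 with
      (Derive_n (fun y => Im (f y)) (m + k) 0 / INR (fact m)) at 2.
    + apply H; [intros; now apply ex|].
      intros i hi; exact (f_equal Im (init i hi)).
    + rewrite (f_equal Im lead : Derive_n (fun y => Im (f y)) (m + k) 0 = 0).
      unfold Rdiv; ring.
Qed.

Lemma Phi_lim (mu : C) (mus : list C) (k m : nat) :
  length mus = (m + k)%nat ->
  is_Clim0 (fun x => CDerive_n (Phi (mu :: mus)) k x / RtoC (x ^ m))%C
    (RtoC (/ INR (fact m))).
Proof.
  intros h; apply fundamental_lim with (mu :: mus); [apply Phi_fundamental|].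
  simpl; now rewrite h.
Qed.

Lemma Phi2_lim (mu nu : C) :
  is_Clim0 (fun x => Phi [mu; nu] x / RtoC x)%C (RtoC 1).
Proof.
  replace (RtoC 1) with (RtoC (/ INR (fact 1))) by (f_equal; simpl; lra).
  eapply is_Clim0_ext; [|now apply (Phi_lim mu [nu] 0 1)].
  apply filter_forall; intros x; now rewrite CDerive_n_0, pow_1.
Qed.

Lemma Phi2_deriv_lim (mu nu : C) :
  is_Clim0 (CDerive (Phi [mu; nu])) (RtoC 1).
Proof.
  replace (RtoC 1) with (RtoC (/ INR (fact 0))) by (f_equal; simpl; lra).
  eapply is_Clim0_ext; [|now apply (Phi_lim mu [nu] 1 0)].
  apply filter_forall; intros x; unfold CDerive; simpl pow; field.
Qed.

Lemma Phi4_lim (l0 l1 l2 l3 : C) :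
  is_Clim0 (fun x => Phi [l0; l1; l2; l3] x / RtoC (x ^ 3))%C (RtoC (/ 6)).
Proof.
  replace (RtoC (/ 6)) with (RtoC (/ INR (fact 3))) by (do 2 f_equal; simpl; lra).
  eapply is_Clim0_ext; [|now apply (Phi_lim l0 [l1; l2; l3] 0 3)].
  apply filter_forall; intros x; now rewrite CDerive_n_0.
Qed.

Lemma Phi4_deriv_lim (l0 l1 l2 l3 : C) :
  is_Clim0 (fun x => CDerive (Phi [l0; l1; l2; l3]) x / RtoC (x ^ 2))%C (RtoC (/ 2)).
Proof.
  replace (RtoC (/ 2)) with (RtoC (/ INR (fact 2))) by (do 2 f_equal; simpl; lra).
  now apply (Phi_lim l0 [l1; l2; l3] 1 2).
Qed.

Lemma Phi2_neq_0 (mu nu : C) :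
  Rbar_locally' 0 (fun x => Phi [mu; nu] x <> RtoC 0).
Proof.
  generalize (is_Clim0_neq _ _ (Phi2_lim mu nu) C1_nz).
  apply filter_imp; intros x hx h; apply hx; rewrite h; unfold Cdiv; ring.
Qed.

Lemma denominator_lim (l0 l1 l2 l3 : C) :
  is_Clim0 (fun x => / ((Phi [l0; l1] x / RtoC x) * (Phi [l2; l3] x / RtoC x)))%C
    (RtoC 1).
Proof.
  assert (h : RtoC 1 <> RtoC 0) by exact C1_nz.
  replace (RtoC 1) with (/ (RtoC 1 * RtoC 1))%C by now field.
  apply is_Clim0_inv; [now rewrite Cmult_1_l|].
  apply is_Clim0_mult; apply Phi2_lim.
Qed.

(** Numerator and denominator are divided by their leading powers [x^3] and
    [x^2]; the factor [x] that is left over is the one divided out. *)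
Lemma sigma_lim (l0 l1 l2 l3 : C) :
  is_Clim0 (fun x => Defs.sigma l0 l1 l2 l3 x / RtoC x)%C (RtoC (/ 6)).
Proof.
  generalize (is_Clim0_mult _ _ _ _ (Phi4_lim l0 l1 l2 l3)
    (denominator_lim l0 l1 l2 l3)); rewrite Cmult_1_r.
  apply is_Clim0_ext.
  generalize (filter_and _ _ near_neq_0
    (filter_and _ _ (Phi2_neq_0 l0 l1) (Phi2_neq_0 l2 l3))).
  apply filter_imp; intros x (hx & h01 & h23).
  unfold Defs.sigma; rewrite RtoC_pow; field; auto.
Qed.

(** Both products in the numerator are of exact order [x^3], with coefficients
    [1/2] and [1/6]. *)
Lemma rho_lim (l0 l1 l2 l3 : C) :
  is_Clim0 (fun x => rho l0 l1 l2 l3 x / RtoC x)%C (RtoC (/ 3)).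
Proof.
  generalize (is_Clim0_mult _ _ _ _
    (is_Clim0_minus _ _ _ _
       (is_Clim0_mult _ _ _ _ (Phi4_deriv_lim l0 l1 l2 l3) (Phi2_lim l0 l1))
       (is_Clim0_mult _ _ _ _ (Phi4_lim l0 l1 l2 l3) (Phi2_deriv_lim l0 l1)))
    (denominator_lim l0 l1 l2 l3)); rewrite !Cmult_1_r.
  replace (RtoC (/ 2) - RtoC (/ 6))%C with (RtoC (/ 3))
    by (rewrite <- RtoC_minus; f_equal; lra).
  apply is_Clim0_ext.
  generalize (filter_and _ _ near_neq_0
    (filter_and _ _ (Phi2_neq_0 l0 l1) (Phi2_neq_0 l2 l3))).
  apply filter_imp; intros x (hx & h01 & h23).
  unfold rho; rewrite !RtoC_pow; field; auto.
Qed.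

Lemma Cmod_sub_linear (f : R -> C) (a eta x : R) :
  x <> 0 -> Cmod (f x / RtoC x - RtoC a)%C < eta ->
  Cmod (f x - RtoC (a * x))%C <= eta * Rabs x.
Proof.
  intros hx h.
  assert (hx' : RtoC x <> RtoC 0) by (intros h'; now apply hx, RtoC_inj).
  replace (f x - RtoC (a * x))%C with ((f x / RtoC x - RtoC a) * RtoC x)%C
    by (rewrite RtoC_mult; now field).
  rewrite Cmod_mult, Cmod_R.
  apply Rmult_le_compat_r; [apply Rabs_pos | lra].
Qed.

(** * The estimate for one row *)

(** [eta] is chosen such that
    [1/6 + eta <= (1/2 + eps) (1/3 - eta)], which is
    [eta (3/2 + eps) <= eps / 3]; the value [eps / (3 (2 + eps))] is enough. *)
Lemma row_estimate (eps eta h h' : R) (r r' s s' : C) :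
  0 < eps -> 0 < h -> 0 < h' -> 0 < eta -> eta * (3 * (2 + eps)) = eps ->
  Cmod (r - RtoC (/ 3 * h))%C <= eta * h ->
  Cmod (r' - RtoC (/ 3 * - h'))%C <= eta * h' ->
  Cmod (s - RtoC (/ 6 * - h))%C <= eta * h ->
  Cmod (s' - RtoC (/ 6 * h'))%C <= eta * h' ->
  Cmod (- s)%C + Cmod s' <= (1 / 2 + eps) * Cmod (r - r')%C.
Proof.
  intros eps0 hh hh' heta heps hr hr' hs hs'.
  assert (bs : Cmod s <= (/ 6 + eta) * h).
  { replace s with ((s - RtoC (/ 6 * - h)) + RtoC (/ 6 * - h))%C by ring.
    eapply Rle_trans; [apply Cmod_triangle|].
    rewrite Cmod_R, Rabs_left by nra; lra. }
  assert (bs' : Cmod s' <= (/ 6 + eta) * h').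
  { replace s' with ((s' - RtoC (/ 6 * h')) + RtoC (/ 6 * h'))%C by ring.
    eapply Rle_trans; [apply Cmod_triangle|].
    rewrite Cmod_R, Rabs_pos_eq by nra; lra. }
  assert (br : (/ 3 - eta) * (h + h') <= Cmod (r - r')%C).
  { assert (e : RtoC (/ 3 * (h + h')) = ((r - r')
      + (- (r - RtoC (/ 3 * h)) + (r' - RtoC (/ 3 * - h'))))%C).
    { replace (/ 3 * (h + h')) with (/ 3 * h - / 3 * - h') by ring.
      rewrite RtoC_minus; ring. }
    apply (f_equal Cmod) in e; rewrite Cmod_R, Rabs_pos_eq in e by nra.
    generalize (Cmod_triangle (r - r')
      (- (r - RtoC (/ 3 * h)) + (r' - RtoC (/ 3 * - h')))%C).
    generalize (Cmod_triangle (- (r - RtoC (/ 3 * h))) (r' - RtoC (/ 3 * - h'))).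
    rewrite Cmod_opp; lra. }
  rewrite Cmod_opp.
  apply Rle_trans with ((/ 6 + eta) * (h + h')); [lra|].
  apply Rle_trans with ((1 / 2 + eps) * ((/ 3 - eta) * (h + h'))).
  - rewrite <- Rmult_assoc; apply Rmult_le_compat_r; [lra|]; nra.
  - apply Rmult_le_compat_l; [lra | exact br].
Qed.

Theorem theorem17 (l0 l1 l2 l3 : C) (eps : R)
  (h01 : conj_invariant [l0; l1])
  (h23 : conj_invariant [l2; l3])
  (heps : 0 < eps) :
  exists delta : R,
    0 < delta /\
    (forall x : R, 0 < x <= delta ->
       Phi [l0; l1] x <> RtoC 0 /\ Phi [l2; l3] x <> RtoC 0) /\
    (forall (n : nat) (t : nat -> R),
       (3 <= n)%nat ->
       (forall j : nat, (1 <= j <= n - 1)%nat -> t j < t (j + 1)%nat) ->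
       (forall j : nat, (1 <= j <= n - 1)%nat -> t (j + 1)%nat - t j <= delta) ->
       forall j : nat, (2 <= j <= n - 1)%nat ->
         Cmod (Rmat l0 l1 l2 l3 t j (j - 1)%nat)
         + Cmod (Rmat l0 l1 l2 l3 t j (j + 1)%nat)
         <= (1 / 2 + eps) * Cmod (Rmat l0 l1 l2 l3 t j j)).
Proof.
  set (eta := eps / (3 * (2 + eps))).
  assert (heta : eta * (3 * (2 + eps)) = eps) by (unfold eta; field; lra).
  assert (eta0 : 0 < eta) by (apply Rdiv_lt_0_compat; lra).
  generalize (filter_and _ _
    (filter_and _ _ (Phi2_neq_0 l0 l1) (Phi2_neq_0 l2 l3))
    (filter_and _ _ (is_Clim0_near _ _ _ (rho_lim l0 l1 l2 l3) eta0)
       (is_Clim0_near _ _ _ (sigma_lim l0 l1 l2 l3) eta0))).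
  intros [d hd].
  assert (near : forall x, x <> 0 -> Rabs x <= d / 2 ->
    (Phi [l0; l1] x <> RtoC 0 /\ Phi [l2; l3] x <> RtoC 0) /\
    Cmod (rho l0 l1 l2 l3 x - RtoC (/ 3 * x))%C <= eta * Rabs x /\
    Cmod (Defs.sigma l0 l1 l2 l3 x - RtoC (/ 6 * x))%C <= eta * Rabs x).
  { intros x hx hxd; destruct (hd x) as (hPhi & hrho & hsigma); [|exact hx|].
    - change (Rabs (x - 0) < d); rewrite Rminus_0_r.
      generalize (cond_pos d); lra.
    - split; [exact hPhi|]; split; now apply Cmod_sub_linear. }
  exists (d / 2); split; [generalize (cond_pos d); lra|]; split.
  - intros x hx; apply near; [lra | rewrite Rabs_pos_eq; lra].
  - intros n t _ incr mesh j hj.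
    assert (hprev := incr (j - 1)%nat ltac:(lia)).
    assert (mprev := mesh (j - 1)%nat ltac:(lia)).
    assert (hnext := incr j ltac:(lia)).
    assert (mnext := mesh j ltac:(lia)).
    replace (j - 1 + 1)%nat with j in hprev, mprev by lia.
    unfold Rmat.
    replace (j - 1 =? j)%nat with false by (symmetry; apply Nat.eqb_neq; lia).
    replace (j - 1 =? j + 1)%nat with false by (symmetry; apply Nat.eqb_neq; lia).
    replace (j - 1 + 1 =? j)%nat with true by (symmetry; apply Nat.eqb_eq; lia).
    replace (j + 1 =? j)%nat with false by (symmetry; apply Nat.eqb_neq; lia).
    rewrite !Nat.eqb_refl.
    set (h := t j - t (j - 1)%nat) in *; set (h' := t (j + 1)%nat - t j) in *.
    assert (0 < h) by (unfold h; lra).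
    assert (0 < h') by (unfold h'; lra).
    assert (ah : Rabs h = h) by (apply Rabs_pos_eq; lra).
    assert (ah' : Rabs h' = h') by (apply Rabs_pos_eq; lra).
    destruct (near h) as (_ & r & _); [lra | lra|].
    destruct (near (- h)) as (_ & _ & s); [lra | rewrite Rabs_Ropp; lra|].
    destruct (near h') as (_ & _ & s'); [lra | lra|].
    destruct (near (- h')) as (_ & r' & _); [lra | rewrite Rabs_Ropp; lra|].
    rewrite ah in r; rewrite Rabs_Ropp, ah' in r'.
    rewrite Rabs_Ropp, ah in s; rewrite ah' in s'.
    now apply row_estimate with eta h h'.
Qed.
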